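(* Let $p,q,r$ be nonnegative integers, where each of the indices attached to a type $\mathbb D$ diagram (the first $i$ of $p,q,r$ in $S^{(i)}_{p,q,r}$) is at least $3$. Define $$F^{(0)}_{p,q}(t)=t^{p+q}-\operatorname{cox}_{\mathbb A_{p-1}}(t)\operatorname{cox}_{\mathbb A_{q-1}}(t),$$ $$F^{(1)}_{p,q}(t)=t^{p+q-2}(t-1)-\left(t^{p-2}+1\right)\operatorname{cox}_{\mathbb A_{q-1}}(t),$$ $$F^{(2)}_{p,q}(t)=t^{p+q-4}(t-1)^2-\left(t^{p-2}+1\right)\left(t^{q-2}+1\right),\qquad F^{(3)}_{p,q}(t)=F^{(2)}_{p,q}(t).$$ (a) For $i\in\{0,1,2\}$, $$\operatorname{cox}_{S^{(i)}_{p,q,r}}(t)=\frac{(t+1)^i}{t-1}\left[t^{r+2}F^{(i)}_{p,q}(t)-\left(F^{(i)}_{p,q}\right)^*(t)\right].$$ (b) $$\operatorname{cox}_{S^{(3)}_{p,q,r}}(t)=(t+1)^3\left[t^{r}F^{(3)}_{p,q}(t)+\left(F^{(3)}_{p,q}\right)^*(t)\right].$$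
   Context: Coxeter polynomial. Let $\Gamma$ be a tree with vertices $v_1,\ldots,v_n$ and adjacency matrix $[a_{ij}]$. For $1\le i\le n$ let $\sigma_i:\mathbb R^n\to\mathbb R^n$ be the linear map with $\sigma_i(e_j)=e_j-(2\delta_{ij}-a_{ij})e_i$, where $e_1,\ldots,e_n$ is the standard basis. The Coxeter transformation is $\Phi_\Gamma=\sigma_1\sigma_2\cdots\sigma_n$, and the Coxeter polynomial is its characteristic polynomial $\operatorname{cox}_\Gamma(t)=\det(t\cdot\mathrm{id}-\Phi_\Gamma)\in\mathbb Z[t]$; it does not depend on the enumeration of the vertices. Join. The join of graphs $\Gamma_1,\ldots,\Gamma_k$ with a fixed vertex $v_j$ in each $\Gamma_j$ is the graph obtained from their disjoint union by adding a new vertex $v$ and an edge from $v$ to $v_j$ for every $j$. Dynkin diagrams. $\mathbb A_n$ is the path with vertices $1,2,\ldots,n$; $\mathbb A_0$ is the empty graph, with $\operatorname{cox}_{\mathbb A_0}(t)=1$, and by convention $\operatorname{cox}_{\mathbb A_{-1}}(t)=0$. For $n\ge 3$, $\mathbb D_n$ is the tree with vertices $1,\ldots,n$ consisting of the path $1,2,\ldots,n-2$ together with two further vertices $n-1$ and $n$, each joined by an edge to the vertex $n-2$. The trees $S^{(i)}_{p_1,p_2,p_3}$. For $0\le i\le 3$, $S^{(i)}_{p_1,p_2,p_3}$ is the join of $\mathbb D_{p_1},\ldots,\mathbb D_{p_i},\mathbb A_{p_{i+1}},\ldots,\mathbb A_{p_3}$ at their vertices numbered $1$. If some type $\mathbb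 A$ index is $0$, the corresponding branch is simply absent. Reciprocal. For a polynomial $f(t)$ of degree $n$, $f^*(t)=t^nf(1/t)$. *)

(* Defs.v *)
From HB Require Import structures.
From mathcomp Require Import all_boot all_order all_algebra.

Set Implicit Arguments.
Unset Strict Implicit.
Unset Printing Implicit Defensive.

Import GRing.Theory.
Local Open Scope ring_scope.

Section Coxeter.

Variables (R : comNzRingType) (T : finType) (adj : rel T).
Variables (n : nat) (v : 'I_n -> T).

Definition basis_vec (j : 'I_n) : 'cV[R]_n := delta_mx j 0.

(* Linear maps act on column vectors: column j is the image of e_j. *)
Definition reflection_mx (i : 'I_n) : 'M[R]_n :=
  \matrix_(k, j)
    (basis_vec j
     - (2 *+ (i == j) - (adj (v i) (v j))%:R) *: basis_vec i) k 0.

Definition coxeter_mx : 'M[R]_n :=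
  \big[mulmx/1%:M]_(i < n) reflection_mx i.

(* Meant for v a bijection, that is, an enumeration of the vertices. *)
Definition coxeter_poly : {poly R} := char_poly coxeter_mx.

Lemma reflection_mxE (i j : 'I_n) :
  reflection_mx i *m basis_vec j =
  basis_vec j - (2 *+ (i == j) - (adj (v i) (v j))%:R) *: basis_vec i.
Proof.
by rewrite -colE; apply/colP => k; rewrite !mxE.
Qed.

End Coxeter.

(* The marked vertex is optional only so as to include the empty graph. *)
Record marked_graph := MarkedGraph {
  vertex : finType;
  edge : rel vertex;
  mark : option vertex
}.

Section Join.

Variables (k : nat) (G : 'I_k -> marked_graph).

(* None is the new vertex; a graph without a marked vertex (the empty graph)
   is not attached to it. *)
Definition join_vertex : finType := option {j : 'I_k & vertex (G j)}.

Definition join_edge : rel join_vertex := fun x y =>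
  match x, y with
  | None, None => false
  | None, Some u | Some u, None => mark (G (tag u)) == Some (tagged u)
  | Some u, Some w =>
      (tag u == tag w) && edge (tagged u) (tagged_as u w)
  end.

End Join.

(* The vertex numbered m in 1, ..., n is the ordinal of value m - 1. *)

Definition edgeA (n : nat) : rel 'I_n :=
  fun i j => (i.+1 == j :> nat) || (j.+1 == i :> nat).

Definition arcD (n i j : nat) : bool :=
  (i.+1 == j) && (j < n - 2)%N || (i == n - 3)%N && (n - 2 <= j)%N.

Definition edgeD (n : nat) : rel 'I_n := fun i j => arcD n i j || arcD n j i.

Definition graphA (n : nat) : marked_graph :=
  MarkedGraph (@edgeA n) (insub 0%N).

(* Meaningful for 3 <= n. *)
Definition graphD (n : nat) : marked_graph :=
  MarkedGraph (@edgeD n) (insub 0%N).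

Definition branch_index (p q r : nat) (j : 'I_3) : nat :=
  nth 0%N [:: p; q; r] j.

Definition branch (i p q r : nat) (j : 'I_3) : marked_graph :=
  if (j < i)%N then graphD (branch_index p q r j)
  else graphA (branch_index p q r j).

Definition starS_vertex (i p q r : nat) : finType :=
  join_vertex (branch i p q r).

Definition starS_edge (i p q r : nat) : rel (starS_vertex i p q r) :=
  @join_edge 3 (branch i p q r).

Definition typeD_ge3 (i p q r : nat) : Prop :=
  forall j : 'I_3, (j < i)%N -> (3 <= branch_index p q r j)%N.

Definition recip (R : nzRingType) (f : {poly R}) : {poly R} :=
  \sum_(i < size f) f`_i *: 'X^((size f).-1 - i).

Lemma horner_recip (K : fieldType) (f : {poly K}) (x : K) :
  x != 0 -> (recip f).[x] = x ^+ (size f).-1 * f.[x^-1].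
Proof.
move=> x0; rewrite /recip horner_sum horner_coef mulr_sumr.
apply: eq_bigr => i _; rewrite hornerZ hornerXn mulrCA exprVn.
have le_i : (i <= (size f).-1)%N by rewrite -ltnS (ltn_predK (ltn_ord i)).
by rewrite -expfB_cond // (negPf x0).
Qed.

Section F.

Variable R : comNzRingType.

Definition coxA (n : nat) : {poly R} := coxeter_poly R (@edgeA n) id.

(* The polynomial of A_(n-1), which is 0 by convention for n = 0. *)
Definition coxA_pred (n : nat) : {poly R} :=
  if n is m.+1 then coxA m else 0.

Definition F0 (p q : nat) : {poly R} :=
  'X^(p + q) - coxA_pred p * coxA_pred q.

Definition F1 (p q : nat) : {poly R} :=
  'X^(p + q - 2) * ('X - 1) - ('X^(p - 2) + 1) * coxA_pred q.

Definition F2 (p q : nat) : {poly R} :=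
  'X^(p + q - 4) * ('X - 1) ^+ 2 - ('X^(p - 2) + 1) * ('X^(q - 2) + 1).

Definition F3 (p q : nat) : {poly R} := F2 p q.

Definition F (i p q : nat) : {poly R} :=
  match i with 0 => F0 p q | 1 => F1 p q | 2 => F2 p q | _ => F3 p q end.

End F.

(* Main.v *)
Require Import Defs.
From HB Require Import structures.
From mathcomp Require Import all_boot all_order all_algebra all_fingroup.
From mathcomp Require Import zify ring.

Set Implicit Arguments.
Unset Strict Implicit.
Unset Printing Implicit Defensive.

Import GRing.Theory.
Local Open Scope ring_scope.

(* Multiplying t - Phi on the left by the unitriangular upper half U of the
   Cartan matrix U + L turns the Coxeter polynomial into
   det (t U + L), which only depends on the products t of opposite entries along
   edges. Over the field of fractions this determinant is computed by Schur
   complements: a branch enters the determinant of the join only through its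
   own determinant and that of the branch without its marked vertex. These
   satisfy f' = (t + 1) f - t g, g' = f when a path is lengthened at the marked
   end, so they are explicit for A_n and D_n, and the formulas reduce to a
   rational identity in t, t^p, t^q, t^r. *)

(** * Reduction of the Coxeter polynomial to a determinant in the Cartan entries *)

Section CoxeterDeterminant.

Variables (R : comNzRingType) (T : finType) (adj : rel T).
Variables (n : nat) (v : 'I_n -> T).

Let cartan (i j : 'I_n) : R := 2 *+ (i == j) - (adj (v i) (v j))%:R.
Let partial_product (s : seq 'I_n) : 'M[R]_n :=
  \big[mulmx/1%:M]_(i <- s) reflection_mx R adj v i.

Lemma mul_reflection_mx m (i : 'I_n) (A : 'M[R]_(n, m)) (k : 'I_n) l :
  (reflection_mx R adj v i *m A) k l =
  A k l - (k == i)%:R * \sum_j cartan i j * A j l.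
Proof.
rewrite mxE mulr_sumr.
transitivity (\sum_j ((k == j)%:R * A j l -
                       (k == i)%:R * (cartan i j * A j l))).
  apply: eq_bigr => j _; rewrite !mxE !andbT mulrBl; congr (_ - _).
  by rewrite mulrA [cartan i j * _]mulrC.
rewrite sumrB; congr (_ - _); rewrite (bigD1 k) //= eqxx mul1r big1 ?addr0 //.
by move=> j jk; rewrite eq_sym (negPf jk) mul0r.
Qed.

(** Build the product from the right. Row [i] changes only when the factor of index [i] is applied;
    by then the rows [j > i] with [j] in [s] are final, and all other rows it reads are still those
    of the identity. *)
Lemma partial_product_row (s : seq 'I_n) (i : 'I_n) l :
  sorted ltn (map val s) ->
  partial_product s i l = if i \in s then
    (i == l)%:R - \sum_j cartan i j *
      (if (j \in s) && (i < j)%N then partial_product s j l else (j == l)%:R)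
  else (i == l)%:R.
Proof.
rewrite /partial_product; elim: s i => [|a s IHs] i /=.
  by rewrite big_nil mxE.
move=> path_as; have sorted_s := path_sorted path_as.
have lt_a k : k \in s -> (a < k)%N.
  move=> ks; have := order_path_min ltn_trans path_as.
  by move/allP/(_ (val k)); apply; exact: map_f.
have tail k : (\big[mulmx/1%:M]_(j <- a :: s) reflection_mx R adj v j) k l =
    if k == a then (\big[mulmx/1%:M]_(j <- s) reflection_mx R adj v j) k l -
      \sum_j cartan a j *
        (\big[mulmx/1%:M]_(j <- s) reflection_mx R adj v j) j l
    else (\big[mulmx/1%:M]_(j <- s) reflection_mx R adj v j) k l.
  rewrite big_cons mul_reflection_mx.
  by case: (k == a); rewrite ?mul1r // mul0r subr0.
rewrite tail inE; have [->|ia] /= := eqVneq i a.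
  have a_s : a \notin s by apply/negP => /lt_a; rewrite ltnn.
  rewrite IHs // (negPf a_s); congr (_ - _); apply: eq_bigr => j _.
  congr (_ * _); rewrite inE; have [->|ja] /= := eqVneq j a.
    by rewrite ltnn IHs // (negPf a_s).
  have [js|js] /= := boolP (j \in s); last by rewrite IHs // (negPf js).
  by rewrite (lt_a _ js) tail (negPf ja).
rewrite IHs //; have [i_s|//] := boolP (i \in s).
congr (_ - _); apply: eq_bigr => j _; congr (_ * _); rewrite inE.
have [->|ja] /= := eqVneq j a; last by rewrite tail (negPf ja).
have lt_ai := lt_a _ i_s.
by rewrite ltnNge (ltnW lt_ai) /= andbF.
Qed.

Let upper : 'M[R]_n := \matrix_(i, j) ((i == j)%:R + (i < j)%N%:R * cartan i j).
Let lower : 'M[R]_n := \matrix_(i, j) ((i == j)%:R + (j < i)%N%:R * cartan i j).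

(** With every index in the product, the row formula rearranges to P_i + sum_{j > i} c_ij P_j = e_i
    - sum_{j <= i} c_ij e_j. The left side is row [i] of the product with [upper]; on the right the
    diagonal contributes 1 - 2 = -1, as there are no loops. *)
Lemma mul_upper_coxeter_mx :
  irreflexive adj -> upper *m coxeter_mx R adj v = - lower.
Proof.
move=> irr; apply/matrixP => i l; rewrite !mxE.
pose P := coxeter_mx R adj v.
have Pil : P i l = (i == l)%:R -
    \sum_j cartan i j * (if (i < j)%N then P j l else (j == l)%:R).
  have := @partial_product_row (index_enum 'I_n) i l.
  rewrite mem_index_enum; under eq_bigr do rewrite mem_index_enum /=.
  apply; have -> : map val (index_enum 'I_n) = iota 0 n.
    by rewrite -val_enum_ord /index_enum unlock enumT.
  exact: iota_ltn_sorted.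
transitivity (P i l + \sum_(j < n) (i < j)%N%:R * cartan i j * P j l).
  under eq_bigr do rewrite mxE mulrDl.
  rewrite big_split /= (bigD1 i) //= eqxx mul1r big1 ?addr0 // => j ji.
  by rewrite eq_sym (negPf ji) mul0r.
rewrite Pil -addrA.
(* The terms with [i < j] cancel; among the others only [j = l] survives. *)
set S := - _ + _; have -> : S = - ((l <= i)%N%:R * cartan i l).
  rewrite /S addrC -sumrB (bigD1 l) //= big1 ?addr0 => [|j /negPf jl].
    rewrite eqxx ltnNge; case: (l <= i)%N => /=; first by rewrite !mul0r; ring.
    by rewrite mul1r; ring.
  by case: (i < j)%N; rewrite ?jl /=; ring.
rewrite leq_eqVlt; have [->|il] := eqVneq l i.
  by rewrite /cartan !eqxx irr ltnn /=; ring.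
by rewrite -[X in X || _]/(l == i) (negPf il) /= sub0r add0r.
Qed.

Lemma coxeter_poly_det : irreflexive adj ->
  coxeter_poly R adj v = \det (\matrix_(i, j)
    if i == j then 'X + 1
    else - ((adj (v i) (v j))%:R * (if (i < j)%N then 'X else 1))).
Proof.
move=> irr; rewrite /coxeter_poly /char_poly.
pose upperX := map_mx polyC upper.
have det_upper : \det upperX = 1.
  rewrite -det_tr det_trig.
    rewrite big1 // => i _.
    by rewrite !mxE eqxx ltnn mul0r addr0.
  apply/is_trig_mxP => i j lt_ij.
  by rewrite !mxE -val_eqE /= gtn_eqF // ltnNge (ltnW lt_ij) mul0r addr0.
rewrite -[LHS]mul1r -[X in X * _]det_upper -det_mulmx /char_poly_mx mulmxBr.
rewrite -map_mxM mul_upper_coxeter_mx // mul_mx_scalar; congr (\det _).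
apply/matrixP => i j; rewrite !mxE /=.
have [->|ij] := eqVneq i j.
  by rewrite ltnn mul0r addr0 polyCN opprK polyC1 mulr1.
rewrite !add0r /cartan (negPf ij) mulr0n sub0r polyCN.
case: ltngtP => [_|_|/val_inj eq_ij]; last by rewrite eq_ij eqxx in ij.
  rewrite mul1r mul0r polyC0 !polyCN polyC_natr; ring.
rewrite mul1r mul0r polyC0 !polyCN polyC_natr; ring.
Qed.

End CoxeterDeterminant.

(* On every edge only the product of the two opposite weights is prescribed:
   this is what makes the determinants below independent of enumerations. *)
Definition coxeter_weight (S : comNzRingType) (t : S) (T : eqType) (e : rel T)
    (w : T -> T -> S) : Prop :=
  (forall x, w x x = t + 1) /\
  (forall x y, x != y -> if e x y then w x y * w y x = t else w x y = 0).

(** Two enumerations differ by one permutation applied to rows and columns alike, so its sign occurs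
    twice. The sizes are equal only by counting, which allows enumerations indexed by sums of branch
    sizes. *)
Lemma det_reindex (S : comNzRingType) (T : Type) (w : T -> T -> S) m n
    (v : 'I_m -> T) (e : 'I_n -> T) : bijective v -> bijective e ->
  \det (\matrix_(i, j) w (v i) (v j)) = \det (\matrix_(i, j) w (e i) (e j)).
Proof.
move=> [v' v'K vK] [e' e'K eK].
have bij_ve : bijective (v' \o e).
  by exists (e' \o v) => i /=; rewrite ?vK ?eK ?v'K ?e'K.
have eq_nm : n = m by have := bij_eq_card bij_ve; rewrite !card_ord.
case: m / eq_nm v v' v'K vK bij_ve => v v' v'K vK bij_ve.
have -> : (\matrix_(i, j) w (e i) (e j)) =
    row_perm (perm (bij_inj bij_ve)) (col_perm (perm (bij_inj bij_ve))
      (\matrix_(i, j) w (v i) (v j))).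
  by apply/matrixP => i j; rewrite !mxE !permE /= !vK.
rewrite row_permE col_permE !det_mulmx !det_perm odd_permV.
by rewrite mulrCA -signr_addb addbb mulr1.
Qed.

(** The order given by [v] is frozen into the weight [w]; after that the vertices may be listed in
    whatever order suits a block decomposition. *)
Lemma coxeter_poly_weight (R : comNzRingType) (T : finType) (adj : rel T) n
    (v : 'I_n -> T) :
  symmetric adj -> irreflexive adj -> bijective v ->
  exists2 w : T -> T -> {poly R}, coxeter_weight 'X adj w &
    forall m (e : 'I_m -> T), bijective e ->
      coxeter_poly R adj v = \det (\matrix_(i, j) w (e i) (e j)).
Proof.
move=> sym irr [v' v'K vK].
pose w x y : {poly R} := if v' x == v' y then 'X + 1 else
  - ((adj x y)%:R * (if (v' x < v' y)%N then 'X else 1)).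
exists w.
  split=> [x|x y xy]; first by rewrite /w eqxx.
  have ne : v' x != v' y by rewrite (can_eq vK).
  rewrite /w [v' y == _]eq_sym (negPf ne) [adj y x]sym.
  case: (adj x y); last by rewrite mul0r oppr0.
  rewrite !mul1r; case: ltngtP => [_|_|/val_inj/eqP]; first by rewrite mulrNN mulr1.
    by rewrite mulrNN mul1r.
  by rewrite (negPf ne).
move=> m e bij_e; rewrite coxeter_poly_det //.
rewrite -(det_reindex w (Bijective v'K vK) bij_e).
by congr (\det _); apply/matrixP => i j; rewrite !mxE /w !v'K.
Qed.

(** * Determinants of the branches and their responses at the marked vertex *)

Section Branches.

Variables (K : fieldType) (t : K).

(** The border added to a weight matrix by one further vertex joined only to the marked index 0; as
    for weights, only the product of the two couplings is fixed. *)
Definition attached n (a : 'rV[K]_n) (b : 'cV[K]_n) : Prop :=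
  forall i : 'I_n,
    if i == 0%N :> nat then a 0 i * b i 0 = t else a 0 i = 0 /\ b i 0 = 0.

Lemma det_bordered n (x : 'M[K]_1) (a : 'rV[K]_n) (b : 'cV[K]_n) (B : 'M[K]_n)
    (s : K) :
  \det B != 0 -> a *m invmx B *m b = s%:M ->
  \det (block_mx x a b B) = \det B * (x 0 0 - s).
Proof.
move=> detB def_s.
have unitB : B \in unitmx by rewrite unitmxE unitfE.
(* Column elimination clears [b] and leaves the Schur complement in the corner. *)
have elim_b : block_mx x a b B *m block_mx 1%:M 0 (- (invmx B *m b)) 1%:M =
              block_mx (x - s%:M) a 0 B.
  rewrite mulmx_block !mulmx1 !mulmx0 !mulmxN mulKVmx // subrr !add0r.
  by rewrite mulmxA def_s.
have := congr1 (fun A => \det A) elim_b.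
rewrite det_mulmx det_lblock !det1 !mulr1 det_ublock det_mx11 => ->.
by rewrite !mxE eqxx mulr1n mulrC.
Qed.

(** The determinant is a Schur complement. An attached border sees only the entry (0, 0) of the
    inverse, which by Cramer's rule is the minor without the marked index divided by the
    determinant. *)
Lemma rooted_extension n (M : 'M[K]_(1 + n)) (s : K) :
  \det (drsubmx M) != 0 ->
  ursubmx M *m invmx (drsubmx M) *m dlsubmx M = s%:M ->
  \det M = \det (drsubmx M) * (M 0 0 - s) /\
  (\det M != 0 -> forall a b, attached a b ->
     a *m invmx M *m b = (t * \det (drsubmx M) / \det M)%:M).
Proof.
move=> detB def_s; split=> [|detM a b att].
  rewrite -{1}(submxK M) (det_bordered _ detB def_s) !mxE.
  by rewrite (_ : lshift n 0 = 0) //; apply: val_inj.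
have unitM : M \in unitmx by rewrite unitmxE unitfE.
have inv00 : invmx M 0 0 = \det (drsubmx M) / \det M.
  rewrite /invmx unitM !mxE /cofactor addn0 expr0 mul1r mulrC; congr (_ / _).
  congr (\det _); apply/matrixP => i j; rewrite !mxE; congr (M _ _);
  exact: val_inj.
apply/matrixP => i j; rewrite !ord1 mxE (bigD1 0) //= big1 => [|k k0].
  rewrite mxE (bigD1 0) //= big1 => [|k k0].
    have := att 0; rewrite /= => ab.
    by rewrite addr0 inv00 mxE -ab eqxx mulr1n; ring.
  have := att k; rewrite -[_ == _ :> nat]/(k == 0) (negPf k0).
  by case=> -> _; rewrite mul0r.
have := att k; rewrite -[_ == _ :> nat]/(k == 0) (negPf k0).
by case=> _ ->; rewrite mulr0.
Qed.

(** Here [g] stands for the determinant of the branch without its marked vertex. Encoding it by the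
    response [t * g / f] rather than by a minor also covers the empty branch, where [g] is 0. *)
Definition rooted_data n (f g : K) (M : 'M[K]_n) : Prop :=
  \det M = f /\ forall a b, attached a b -> a *m invmx M *m b = (t * g / f)%:M.

(** The Schur complement at the new marked vertex is [t + 1 - t * g / f], whence the recursion;
    deleting that vertex gives back the old branch, so [f] takes the place of [g]. *)
Lemma rooted_data_extension n (e : rel 'I_(1 + n)) (e' : rel 'I_n) (f g f' : K)
    (M : 'M[K]_(1 + n)) :
  (forall i j, e (rshift 1 i) (rshift 1 j) = e' i j) ->
  (forall i, e ord0 (rshift 1 i) = (i == 0%N :> nat)) ->
  (forall i, e (rshift 1 i) ord0 = (i == 0%N :> nat)) ->
  f != 0 -> f' != 0 -> f' = (t + 1) * f - t * g ->
  (forall B : 'M_n, coxeter_weight t e' B -> rooted_data f g B) ->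
  coxeter_weight t e M -> rooted_data f' f M.
Proof.
move=> e_shift e_root e_root' f0 f'0 def_f' dataB [diag off].
have lshift00 : lshift n 0 = ord0 :> 'I_(1 + n) by apply: val_inj.
have weightB : coxeter_weight t e' (drsubmx M).
  split=> [i|i j ij]; rewrite !mxE ?diag // -e_shift; apply: off.
  by apply: contra ij => /eqP/rshift_inj->.
have att : attached (ursubmx M) (dlsubmx M).
  move=> i; rewrite !mxE lshift00.
  have ne0 : ord0 != rshift 1 i by [].
  have := off _ _ ne0; rewrite e_root; rewrite eq_sym in ne0.
  by have := off _ _ ne0; rewrite e_root'; case: eqP.
have [detB resp] := dataB _ weightB.
have [||detM respM] := @rooted_extension n M (t * g / f).
- by rewrite detB.
- exact: resp.
have def_detM : \det M = f' by rewrite detM detB (diag 0) def_f'; field.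
by split=> // a b ab; rewrite respM ?def_detM // detB.
Qed.

Hypothesis not_root1 : forall k, t ^+ k.+1 != 1.

Let t1 : t - 1 != 0.
Proof. by rewrite subr_eq0 -[t]expr1 not_root1. Qed.

(** Otherwise squaring would make [t] a root of unity. Such facts keep the determinants of all
    branches invertible. *)
Lemma expr_addr1_neq0 k : t ^+ k.+1 + 1 != 0.
Proof.
apply: contra (not_root1 (k.+1 + k)) => /eqP tk.
have {}tk : t ^+ k.+1 = -1 by apply/eqP; rewrite -addr_eq0 tk.
by rewrite -addnS exprD tk mulrNN mulr1.
Qed.

(** This is the Coxeter polynomial of A_(n-1) evaluated at [t]; it vanishes for [n = 0], in
    accordance with the convention for A_(-1). *)
Definition q_number (n : nat) : K := (t ^+ n - 1) / (t - 1).

Lemma q_numberS_neq0 n : q_number n.+1 != 0.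
Proof. by rewrite mulf_neq0 ?invr_eq0 // subr_eq0 not_root1. Qed.

Lemma rooted_data_A n (M : 'M[K]_n) :
  coxeter_weight t (@edgeA n) M -> rooted_data (q_number n.+1) (q_number n) M.
Proof.
elim: n M => [|n IHn] M.
  move=> _; split=> [|a b _]; first by rewrite det_mx00 /q_number expr1 divff.
  apply/matrixP => i j; rewrite mxE big_ord0 !ord1 mxE.
  by rewrite /q_number expr0 subrr !mul0r mulr0 mul0r mul0rn.
move=> M_weight.
apply: (@rooted_data_extension n (@edgeA n.+1) (@edgeA n) _ (q_number n)).
- by [].
- by move=> i; rewrite /edgeA /= orbF eqSS eq_sym.
- by move=> i; rewrite /edgeA /= eqSS eq_sym.
- exact: q_numberS_neq0.
- exact: q_numberS_neq0.
- by rewrite /q_number !exprS; field.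
- exact: IHn.
- exact: M_weight.
Qed.

(** Prefixing a vertex moves the thresholds [n - 2] and [n - 3] by exactly one, because neither
    subtraction is truncated. *)
Lemma edgeD_shift n : (3 <= n)%N -> forall i j : 'I_n,
  @edgeD n.+1 (rshift 1 i) (rshift 1 j) = edgeD i j.
Proof. by move=> n3 i j; rewrite /edgeD /arcD /=; lia. Qed.

(* [(t + 1) (t ^ (n - 1) + 1)] is the Coxeter polynomial of [D_n]. *)
Lemma rooted_data_D n (M : 'M[K]_n) :
  (3 <= n)%N -> coxeter_weight t (@edgeD n) M ->
  rooted_data ((t + 1) * (t ^+ n.-1 + 1)) ((t + 1) * (t ^+ n.-2 + 1)) M.
Proof.
case: n M => [|[|[|n]]] //= M _; elim: n M => [|n IHn] M.
  move=> [diag off].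
  have t_add1 : t + 1 != 0 by exact: (expr_addr1_neq0 0).
  (* In D_3 the marked vertex is the branching one; without it two isolated vertices remain, each
     with response [t / (t + 1)]. *)
  have scalarB : drsubmx (M : 'M_(1 + 2)) = (t + 1)%:M.
    apply/matrixP => i j; rewrite !mxE; have [->|ij] := eqVneq i j.
      exact: diag.
    have ne_ij : rshift 1 i != rshift 1 j.
      by apply: contra ij => /eqP/rshift_inj->.
    have := off _ _ ne_ij; rewrite /edgeD /arcD /=; have := ltn_ord i.
    by rewrite mulr0n; case: ifP => //; lia.
  have detB : \det (drsubmx (M : 'M_(1 + 2))) = (t + 1) ^+ 2.
    by rewrite scalarB det_scalar.
  have [||detM resp] := @rooted_extension 2 M (2 * t / (t + 1)).
  - by rewrite detB expf_neq0.
  - rewrite scalarB invmx_scalar mul_mx_scalar -scalemxAl.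
    apply/matrixP => i j; rewrite !ord1 !mxE !big_ord_recl big_ord0 !mxE.
    have -> : lshift 2 0 = ord0 :> 'I_(1 + 2) by apply: val_inj.
    have := off ord0 (rshift 1 0) isT; have := off ord0 (rshift 1 (lift ord0 ord0)) isT.
    by rewrite /edgeD /arcD /= => -> ->; rewrite ?eqxx ?mulr1n; ring.
  have {}detM : \det M = (t + 1) * (t ^+ 2 + 1).
    by rewrite detM detB (diag 0); field.
  split=> // a b ab; rewrite resp // detM ?detB //.
  by rewrite mulf_neq0 ?(expr_addr1_neq0 1).
apply: (@rooted_data_extension n.+3 (@edgeD n.+4) (@edgeD n.+3) _
  ((t + 1) * (t ^+ n.+1 + 1))).
- exact: edgeD_shift.
- move=> i; have := ltn_ord i; rewrite /edgeD /arcD /=; lia.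
- move=> i; have := ltn_ord i; rewrite /edgeD /arcD /=; lia.
- by rewrite mulf_neq0 ?(expr_addr1_neq0 0) ?expr_addr1_neq0.
- by rewrite mulf_neq0 ?(expr_addr1_neq0 0) ?expr_addr1_neq0.
- by rewrite !exprS; ring.
- exact: IHn.
Qed.

End Branches.

(** * The determinant of a join of three branches *)

Section Joins.

Variables (K : fieldType) (t : K).

(** The analogue of [rooted_data] for an abstract vertex type, uniform in the weight. Without a
    marked vertex all couplings vanish, as they should for an absent branch. *)
Definition branch_data (G : marked_graph) (f g : K) : Prop :=
  f != 0 /\ forall w : vertex G -> vertex G -> K,
    coxeter_weight t (@edge G) w ->
  exists n (e : 'I_n -> vertex G), let M := \matrix_(i, j) w (e i) (e j) in
  [/\ bijective e, \det M = f &
   forall a b : vertex G -> K,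
     (forall x, if mark G == Some x then a x * b x = t
                else a x = 0 /\ b x = 0) ->
     \row_i a (e i) *m invmx M *m \col_i b (e i) = (t * g / f)%:M].

Lemma branch_data_ord n (e : rel 'I_n) (f g : K) :
  f != 0 -> (forall M : 'M_n, coxeter_weight t e M -> rooted_data t f g M) ->
  branch_data (MarkedGraph e (insub 0%N)) f g.
Proof.
move=> f0 dataM; split=> // w [diag off].
have [] := dataM (\matrix_(i, j) w i j).
  by split=> [i|i j ij]; rewrite !mxE ?diag //; apply: off.
move=> detM resp; exists n, id; split=> //; first by exists id.
move=> a b ab; apply: resp => i; rewrite !mxE; have := ab i => /=.
have -> // : (insub 0%N == Some i) = (i == 0%N :> nat).
case: insubP => [j _ j0|n0]; first by rewrite (inj_eq Some_inj) eq_sym -j0.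
by have := ltn_ord i; case: (i : nat) => [|//]; rewrite (negPf n0).
Qed.

(** The inverse is block diagonal too, so responses of disjoint branches to a common vertex add
    up. *)
Lemma response_block_diag n1 n2 (A : 'M[K]_n1) (B : 'M[K]_n2) a1 a2 b1 b2 s1 s2 :
  \det A != 0 -> \det B != 0 ->
  a1 *m invmx A *m b1 = s1%:M -> a2 *m invmx B *m b2 = s2%:M ->
  row_mx a1 a2 *m invmx (block_mx A 0 0 B) *m col_mx b1 b2 = (s1 + s2)%:M :> 'M_1.
Proof.
move=> detA detB resA resB.
rewrite invmx_block_diag ?block_diag_mx_unit ?unitmxE ?unitfE ?detA ?detB //.
rewrite mul_row_block !mulmx0 addr0 add0r mul_row_col resA resB.
by rewrite -raddfD.
Qed.

Local Notation o0 := (@ord0 2).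
Local Notation o1 := (lift ord0 (@ord0 1)).
Local Notation o2 := (lift ord0 (lift ord0 (@ord0 0))).

(** The new vertex borders a block diagonal matrix of determinant [f0 * f1 * f2], with Schur
    complement [t + 1] minus the sum of the three responses [t * g / f]. *)
Lemma join3_det (G : 'I_3 -> marked_graph) (f0 g0 f1 g1 f2 g2 : K)
    (w : join_vertex G -> join_vertex G -> K) :
  branch_data (G o0) f0 g0 -> branch_data (G o1) f1 g1 ->
  branch_data (G o2) f2 g2 -> coxeter_weight t (@join_edge 3 G) w ->
  exists n, exists2 e : 'I_n -> join_vertex G, bijective e &
    \det (\matrix_(i, j) w (e i) (e j)) =
    (t + 1) * f0 * f1 * f2 - t * (g0 * f1 * f2 + f0 * g1 * f2 + f0 * f1 * g2).
Proof.
move=> [f0nz data0] [f1nz data1] [f2nz data2] [diag off].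
pose emb j (x : vertex (G j)) : join_vertex G :=
  Some (Tagged (fun j => vertex (G j)) x).
have emb_inj j : injective (@emb j).
  by move=> x y /Some_inj/eqP; rewrite eq_Tagged => /eqP.
have weight j : coxeter_weight t (@edge (G j)) (fun x y => w (emb j x) (emb j y)).
  split=> [x|x y xy]; first exact: diag.
  have := off (emb j x) (emb j y); rewrite (inj_eq (@emb_inj j)) => /(_ xy).
  by rewrite /join_edge /= eqxx tagged_asE.
have cross j k x y : j != k -> w (emb j x) (emb k y) = 0.
  move=> jk; have := off (emb j x) (emb k y); rewrite /join_edge /= (negPf jk) /=.
  by apply; apply: contra jk => /eqP/Some_inj/(congr1 tag) /= ->.
have att j x : if mark (G j) == Some x
    then w None (emb j x) * w (emb j x) None = t
    else w None (emb j x) = 0 /\ w (emb j x) None = 0.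
  have := off None (emb j x) isT; have := off (emb j x) None isT.
  by rewrite /join_edge /=; case: ifP.
have [n0 [e0 [bij0 det0 /(_ _ _ (@att _)) res0]]] := data0 _ (weight _).
have [n1 [e1 [bij1 det1 /(_ _ _ (@att _)) res1]]] := data1 _ (weight _).
have [n2 [e2 [bij2 det2 /(_ _ _ (@att _)) res2]]] := data2 _ (weight _).
(* The new vertex comes first and the branches follow in order, which gives the matrix the shape
   required by [det_bordered]. *)
pose e (i : 'I_(1 + (n0 + (n1 + n2)))) : join_vertex G :=
  match split i with
  | inl _ => None
  | inr i' => match split i' with
    | inl i0 => emb _ (e0 i0)
    | inr i'' => match split i'' with
      | inl i1 => emb _ (e1 i1)
      | inr i2 => emb _ (e2 i2) end end end.
have eN i : e (lshift _ i) = None by rewrite /e (unsplitK (inl i)).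
have eE0 i : e (rshift _ (lshift _ i)) = emb _ (e0 i).
  by rewrite /e (unsplitK (inr _)) (unsplitK (inl _)).
have eE1 i : e (rshift _ (rshift _ (lshift _ i))) = emb _ (e1 i).
  by rewrite /e !(unsplitK (inr _)) (unsplitK (inl _)).
have eE2 i : e (rshift _ (rshift _ (rshift _ i))) = emb _ (e2 i).
  by rewrite /e !(unsplitK (inr _)).
have e_inj : injective e.
  move=> i j.
  case: (split_ordP i) => {i} [i ->|i ->]; last case: (split_ordP i) => {i} [i ->|i ->];
    last case: (split_ordP i) => {i} [i ->|i ->];
  (case: (split_ordP j) => {j} [j ->|j ->]; last case: (split_ordP j) => {j} [j ->|j ->];
    last case: (split_ordP j) => {j} [j ->|j ->]);
  rewrite ?eN ?eE0 ?eE1 ?eE2 //; try by move/Some_inj/(congr1 tag).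
  - by rewrite !ord1.
  - by move/emb_inj/(bij_inj bij0)->.
  - by move/emb_inj/(bij_inj bij1)->.
  - by move/emb_inj/(bij_inj bij2)->.
have bij_e : bijective e.
  apply: inj_card_bij => //.
  rewrite card_option card_tagged sumnE big_map big_enum /=.
  rewrite !big_ord_recl big_ord0 card_ord addn0 add1n ltnS.
  by rewrite -(bij_eq_card bij0) -(bij_eq_card bij1) -(bij_eq_card bij2) !card_ord.
exists (1 + (n0 + (n1 + n2)))%N, e => //.
set M0 := (\matrix_(i, j) _) in det0 res0; set M1 := (\matrix_(i, j) _) in det1 res1.
set M2 := (\matrix_(i, j) _) in det2 res2.
have -> : \matrix_(i, j) w (e i) (e j) = block_mx (t + 1)%:M
   (row_mx (\row_i w None (emb _ (e0 i)))
     (row_mx (\row_i w None (emb _ (e1 i))) (\row_i w None (emb _ (e2 i)))))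
   (col_mx (\col_i w (emb _ (e0 i)) None)
     (col_mx (\col_i w (emb _ (e1 i)) None) (\col_i w (emb _ (e2 i)) None)))
   (block_mx M0 0 0 (block_mx M1 0 0 M2)).
  apply/matrixP => i j; rewrite mxE.
  case: (split_ordP i) => {i} [i ->|i ->]; last case: (split_ordP i) => {i} [i ->|i ->];
    last case: (split_ordP i) => {i} [i ->|i ->];
  (case: (split_ordP j) => {j} [j ->|j ->]; last case: (split_ordP j) => {j} [j ->|j ->];
    last case: (split_ordP j) => {j} [j ->|j ->]);
  rewrite ?(block_mxEul, block_mxEur, block_mxEdl, block_mxEdr, row_mxEl,
    row_mxEr, col_mxEu, col_mxEd) ?mxE ?eN ?eE0 ?eE1 ?eE2 ?mxE ?diag //;
  try by rewrite cross.
  by rewrite !ord1 eqxx.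
have detM12 : \det (block_mx M1 0 0 M2) = f1 * f2.
  by rewrite det_ublock det1 det2.
have detM012 : \det (block_mx M0 0 0 (block_mx M1 0 0 M2)) = f0 * (f1 * f2).
  by rewrite det_ublock det0 detM12.
have detnz : \det (block_mx M0 0 0 (block_mx M1 0 0 M2)) != 0.
  by rewrite detM012 !mulf_neq0.
rewrite (det_bordered _ detnz (s := t * g0 / f0 + (t * g1 / f1 + t * g2 / f2))).
  by rewrite detM012 mxE mulr1n; field; rewrite f0nz f1nz f2nz.
apply: response_block_diag => //; rewrite ?det0 ?detM12 ?mulf_neq0 //.
by apply: response_block_diag => //; rewrite ?det1 ?det2.
Qed.

End Joins.

(** * The two formulas as rational identities in a field *)

Section StarIdentities.

Variables (K : fieldType) (t : K).
Hypotheses (t_neq0 : t != 0) (t_neq1 : t - 1 != 0).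

(** This factor comes from the denominator [t^-1 - 1 = (1 - t) / t] of [q_number] at [t^-1]. *)
Let t_neq1' : 1 - t != 0.
Proof. by rewrite -opprB oppr_eq0. Qed.

Definition star_value (f0 g0 f1 g1 f2 g2 : K) : K :=
  (t + 1) * f0 * f1 * f2 - t * (g0 * f1 * f2 + f0 * g1 * f2 + f0 * f1 * g2).

Definition branch_value (d : bool) (n : nat) : K :=
  if d then (t + 1) * (t ^+ n.-1 + 1) else q_number t n.+1.

(* The value of the branch without its marked vertex. *)
Definition branch_value' (d : bool) (n : nat) : K :=
  if d then (t + 1) * (t ^+ n.-2 + 1) else q_number t n.

Definition star_branches (i p q r : nat) : K :=
  star_value (branch_value (0 < i)%N p) (branch_value' (0 < i)%N p)
             (branch_value (1 < i)%N q) (branch_value' (1 < i)%N q)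
             (branch_value (2 < i)%N r) (branch_value' (2 < i)%N r).

(** The argument [x] is separate from [t] because the reciprocal is expressed through the value at
    [t^-1]. *)
Definition F_value (x : K) (i p q : nat) : K :=
  match i with
  | 0 => x ^+ (p + q) - q_number x p * q_number x q
  | 1 => x ^+ (p + q - 2) * (x - 1) - (x ^+ (p - 2) + 1) * q_number x q
  | _ => x ^+ (p + q - 4) * (x - 1) ^+ 2 - (x ^+ (p - 2) + 1) * (x ^+ (q - 2) + 1)
  end.

Definition F_degree (i p q : nat) : nat := (p + q - i)%N.

Lemma star_branches_leq2 (i p q r : nat) :
  (i <= 2)%N -> ((0 < i)%N -> (3 <= p)%N) -> ((1 < i)%N -> (3 <= q)%N) ->
  star_branches i p q r = (t + 1) ^+ i / (t - 1) *
    (t ^+ (r + 2) * F_value t i p q - t ^+ F_degree i p q * F_value t^-1 i p q).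
Proof.
rewrite /star_branches /star_value /branch_value /branch_value' /F_degree.
case: i => [|[|[|//]]] _ /=.
- move=> _ _; rewrite /q_number subn0 !exprVn !exprD !exprS.
  have := expf_neq0 p t_neq0; have := expf_neq0 q t_neq0.
  (* From here the three powers are independent parameters, and the identity is one of rational
     functions. *)
  move: (t ^+ p) (t ^+ q) (t ^+ r) => P Q S Q0 P0.
  by field; rewrite ?mulN1r ?t_neq0 ?t_neq1 ?t_neq1' ?P0 ?Q0.
(* Replacing [p] by [p + 3] turns the truncated exponents into genuine ones. *)
- move=> /(_ isT); case: p => [|[|[|p]]] // _ _.
  rewrite /q_number !addSn !subSS !subn0 /= !exprVn !(exprD, exprS).
  have := expf_neq0 p t_neq0; have := expf_neq0 q t_neq0.
  move: (t ^+ p) (t ^+ q) (t ^+ r) => P Q S Q0 P0.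
  by field; rewrite ?mulN1r ?t_neq0 ?t_neq1 ?t_neq1' ?P0 ?Q0.
move=> /(_ isT); case: p => [|[|[|p]]] // _ /(_ isT).
case: q => [|[|[|q]]] // _.
rewrite /q_number !(addSn, addnS) !subSS !subn0 /= !exprVn !(exprD, exprS).
have := expf_neq0 p t_neq0; have := expf_neq0 q t_neq0.
move: (t ^+ p) (t ^+ q) (t ^+ r) => P Q S Q0 P0.
by field; rewrite ?mulN1r ?t_neq0 ?t_neq1 ?t_neq1' ?P0 ?Q0.
Qed.

(** With three type D branches no [q_number] occurs, hence no denominator [t - 1]. The degree is the
    one for index 2, since both indices share the same polynomial. *)
Lemma star_branches3 (p q r : nat) :
  (3 <= p)%N -> (3 <= q)%N -> (3 <= r)%N ->
  star_branches 3 p q r = (t + 1) ^+ 3 *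
    (t ^+ r * F_value t 3 p q + t ^+ F_degree 2 p q * F_value t^-1 3 p q).
Proof.
rewrite /star_branches /star_value /branch_value /branch_value' /F_degree /=.
case: p q r => [|[|[|p]]] // [|[|[|q]]] // [|[|[|r]]] // _ _ _.
rewrite !(addSn, addnS) !subSS !subn0 /= !exprVn !(exprD, exprS).
have := expf_neq0 p t_neq0; have := expf_neq0 q t_neq0.
move: (t ^+ p) (t ^+ q) (t ^+ r) => P Q S Q0 P0.
by field; rewrite ?t_neq0 ?P0 ?Q0.
Qed.

End StarIdentities.

(** * Symmetry and absence of loops in the trees *)

Section Graphs.

Lemma edgeA_sym n : symmetric (@edgeA n).
Proof. by move=> i j; rewrite /edgeA orbC. Qed.

Lemma edgeA_irr n : irreflexive (@edgeA n).
Proof. by move=> i; rewrite /edgeA; lia. Qed.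

Lemma edgeD_sym n : symmetric (@edgeD n).
Proof. by move=> i j; rewrite /edgeD orbC. Qed.

(** For [n] equal to 1 or 2 truncated subtraction would create a loop at index 0. *)
Lemma edgeD_irr n : (3 <= n)%N -> irreflexive (@edgeD n).
Proof. by move=> n3 i; rewrite /edgeD /arcD; lia. Qed.

Lemma join_edge_sym k (G : 'I_k -> marked_graph) :
  (forall j, symmetric (@edge (G j))) -> symmetric (@join_edge k G).
Proof.
move=> symG [[j x]|] [[k' y]|] //=.
have [eq_jk|] //= := eqVneq j k'.
by case: k' / eq_jk y => y; rewrite !tagged_asE symG.
Qed.

Lemma join_edge_irr k (G : 'I_k -> marked_graph) :
  (forall j, irreflexive (@edge (G j))) -> irreflexive (@join_edge k G).
Proof. by move=> irrG [[j x]|] //=; rewrite eqxx tagged_asE irrG. Qed.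

Lemma starS_edge_sym i p q r : symmetric (@starS_edge i p q r).
Proof.
apply: join_edge_sym => j; rewrite /branch.
by case: ifP => _; [exact: edgeD_sym | exact: edgeA_sym].
Qed.

Lemma starS_edge_irr i p q r :
  typeD_ge3 i p q r -> irreflexive (@starS_edge i p q r).
Proof.
move=> ge3; apply: join_edge_irr => j; rewrite /branch.
by case: ifP => [/ge3|_]; [exact: edgeD_irr | exact: edgeA_irr].
Qed.

End Graphs.

(** * Passage to the fraction field of the polynomial ring, and reciprocals *)

Section Fractions.

Variable R : idomainType.

Local Notation K := {fraction {poly R}}.
Local Notation T := (tofrac ('X : {poly R})).

Let polyXn_neq1 k : 'X^(k.+1) != 1 :> {poly R}.
Proof.
apply/eqP => /(congr1 (fun p : {poly R} => size p)).
by rewrite size_polyXn size_poly1.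
Qed.

Lemma fracX_not_root1 k : T ^+ k.+1 != 1.
Proof. by rewrite -rmorphXn -(rmorph1 (@tofrac _)) tofrac_eq polyXn_neq1. Qed.

Lemma fracX_neq0 : T != 0.
Proof. by rewrite tofrac_eq0 polyX_eq0. Qed.

Lemma fracX_sub1_neq0 : T - 1 != 0.
Proof. by rewrite subr_eq0 -[T]expr1 fracX_not_root1. Qed.

Lemma tofrac_coxeter_poly (V : finType) (adj : rel V) n (v : 'I_n -> V) :
  symmetric adj -> irreflexive adj -> bijective v ->
  exists2 w : V -> V -> K, coxeter_weight T adj w &
    forall m (e : 'I_m -> V), bijective e ->
      tofrac (coxeter_poly R adj v) = \det (\matrix_(i, j) w (e i) (e j)).
Proof.
move=> sym irr bij_v.
have [w [diag off] detw] := coxeter_poly_weight R sym irr bij_v.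
exists (fun x y => tofrac (w x y)).
  split=> [x|x y xy]; first by rewrite diag rmorphD rmorph1.
  have := off _ _ xy; case: (adj x y) => [<-|->]; last exact: rmorph0.
  by rewrite rmorphM.
move=> m e bij_e; rewrite (detw _ _ bij_e) -det_map_mx; congr (\det _).
by apply/matrixP => i j; rewrite !mxE.
Qed.

Lemma tofrac_coxA n : tofrac (coxA R n) = q_number T n.+1.
Proof.
have bij_id : bijective (@id 'I_n) by exists id.
have [w weight detw] :=
  tofrac_coxeter_poly (@edgeA_sym n) (@edgeA_irr n) bij_id.
rewrite /coxA (detw _ _ bij_id).
apply: (rooted_data_A fracX_not_root1 _).1.
by case: weight => diag off; split=> [i|i j ij]; rewrite !mxE ?diag //; apply: off.
Qed.

(** Free of division, this identity can be pushed through any ring morphism, including the one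
    sending the indeterminate to its inverse. *)
Lemma coxA_predE n : coxA_pred R n * ('X - 1) = 'X^n - 1.
Proof.
apply/eqP; rewrite -tofrac_eq rmorphM !rmorphB /= rmorphXn rmorph1.
case: n => [|n] /=; first by rewrite rmorph0 mul0r expr0 subrr.
by rewrite tofrac_coxA /q_number divfK // fracX_sub1_neq0.
Qed.

Lemma size_coxA_pred n : size (coxA_pred R n) = n.
Proof. by case: n => [|n] /=; rewrite ?size_poly0 // /coxA size_char_poly. Qed.

Lemma branch_data_branch i p q r (j : 'I_3) : typeD_ge3 i p q r ->
  branch_data T (branch i p q r j)
    (branch_value T (j < i)%N (branch_index p q r j))
    (branch_value' T (j < i)%N (branch_index p q r j)).
Proof.
move=> ge3; rewrite /branch /branch_value /branch_value'.
have nz := fracX_not_root1.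
case: ifP => [/ge3 n3|_]; apply: branch_data_ord => [|M].
- case: (branch_index _ _ _ _) n3 => [|[|k]] //= _.
  by rewrite mulf_neq0 ?(expr_addr1_neq0 nz) // (expr_addr1_neq0 nz 0).
- exact: rooted_data_D.
- exact: q_numberS_neq0.
exact: rooted_data_A.
Qed.

Lemma tofrac_coxeter_starS i p q r n (v : 'I_n -> starS_vertex i p q r) :
  typeD_ge3 i p q r -> bijective v ->
  tofrac (coxeter_poly R (@starS_edge i p q r) v) = star_branches T i p q r.
Proof.
move=> ge3 bij_v.
have [w weight detw] :=
  tofrac_coxeter_poly (@starS_edge_sym i p q r) (starS_edge_irr ge3) bij_v.
have [m [e bij_e det_e]] := join3_det (branch_data_branch _ ge3)
  (branch_data_branch _ ge3) (branch_data_branch _ ge3) weight.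
by rewrite (detw _ _ bij_e) det_e.
Qed.

(** The morphism [phi] substitutes the inverse of the indeterminate; being a ring morphism, it can
    be computed on [F] factor by factor. *)
Lemma tofrac_recip : exists phi : {rmorphism {poly R} -> K},
  phi 'X = T^-1 /\
  forall f, tofrac (recip f) = T ^+ (size f).-1 * phi f.
Proof.
pose c := @tofrac {poly R} \o polyC.
pose phi : {rmorphism {poly R} -> K} := horner_eval T^-1 \o map_poly c.
exists phi; split=> [|f].
  by rewrite /= map_polyX /horner_eval hornerX.
have phiE : phi f = \sum_(i < size f) c f`_i * T^-1 ^+ i.
  rewrite {1}(_ : f = \poly_(i < size f) f`_i); last by rewrite coefK.
  rewrite poly_def rmorph_sum /=; apply: eq_bigr => i _.
  by rewrite /horner_eval map_polyZ map_polyXn hornerZ hornerXn.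
rewrite phiE /recip rmorph_sum mulr_sumr; apply: eq_bigr => i _.
have le_i : (i <= (size f).-1)%N by rewrite -ltnS (ltn_predK (ltn_ord i)).
rewrite -mul_polyC rmorphM rmorphXn /= mulrCA exprVn; congr (_ * _).
by rewrite expfB_cond // (negPf fracX_neq0).
Qed.

(** Since [recip] depends on the actual degree, the leading power must be shown to survive: the
    subtracted product always has smaller degree. *)
Lemma size_F i p q : (i <= 3)%N ->
  ((0 < i)%N -> (3 <= p)%N) -> ((1 < i)%N -> (3 <= q)%N) ->
  (size (F R i p q)).-1 = F_degree (minn i 2) p q.
Proof.
have sizeB (f g : {poly R}) : (size g < size f)%N -> size (f - g) = size f.
  by move=> lt_gf; rewrite size_polyDl // size_polyN.
have size_Xn1 n : (0 < n)%N -> size ('X^n + 1 : {poly R}) = n.+1.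
  exact: size_XnaddC.
have size_X1 k n : size ('X^n * ('X - 1) ^+ k : {poly R}) = (n + k).+1.
  rewrite size_monicM ?monicXn ?expf_neq0 -?polyC1 ?polyXsubC_eq0 //.
  by rewrite size_exp_XsubC size_polyXn addnS.
have size2 : (3 <= p)%N -> (3 <= q)%N -> (size (F2 R p q)).-1 = F_degree 2 p q.
  move=> p3 q3; rewrite /F2 /F_degree sizeB size_X1; first by lia.
  apply: leq_ltn_trans (size_polyMleq _ _) _.
  by rewrite !size_Xn1; lia.
case: i => [|[|[|[|//]]]] _ p3 q3; rewrite /F /F_degree.
- rewrite /F0 sizeB size_polyXn; first by rewrite subn0.
  apply: leq_ltn_trans (size_polyMleq _ _) _.
  by rewrite !size_coxA_pred; lia.
- have {}p3 := p3 isT.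
  have := size_X1 1%N; rewrite /F1 expr1 => {}size_X1.
  rewrite sizeB size_X1; first by rewrite /minn /=; lia.
  apply: leq_ltn_trans (size_polyMleq _ _) _.
  by rewrite size_coxA_pred size_Xn1; lia.
- by rewrite size2 ?p3 ?q3.
- by rewrite size2 ?p3 ?q3.
Qed.

Lemma rmorph_F (phi : {rmorphism {poly R} -> K}) i p q :
  phi 'X - 1 != 0 -> phi (F R i p q) = F_value (phi 'X) i p q.
Proof.
move=> x1.
have phiA n : phi (coxA_pred R n) = q_number (phi 'X) n.
  have := congr1 phi (coxA_predE n).
  by rewrite rmorphM !rmorphB rmorphXn rmorph1 /q_number => <-; rewrite mulfK.
by case: i => [|[|[|i]]]; rewrite /F /F0 /F1 /F3 /F2;
  rewrite !(rmorphB, rmorphM, rmorphXn, rmorphD, rmorph1) ?phiA.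
Qed.

End Fractions.

Theorem theorem2p2 (R : realDomainType) (p q r : nat) :
  (forall i : nat, (i <= 2)%N -> typeD_ge3 i p q r ->
     forall (n : nat) (v : 'I_n -> starS_vertex i p q r), bijective v ->
       tofrac (coxeter_poly R (@starS_edge i p q r) v) =
       tofrac (('X + 1) ^+ i) / tofrac ('X - 1) *
       tofrac ('X^(r + 2) * F R i p q - recip (F R i p q)))
  /\
  (typeD_ge3 3 p q r ->
     forall (n : nat) (v : 'I_n -> starS_vertex 3 p q r), bijective v ->
       coxeter_poly R (@starS_edge 3 p q r) v =
       ('X + 1) ^+ 3 * ('X^r * F R 3 p q + recip (F R 3 p q))).
Proof.
have [phi [phiX recipE]] := tofrac_recip R.
have X0 := fracX_neq0 R; have X1 := fracX_sub1_neq0 R.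
have phiX1 : phi 'X - 1 != 0 by rewrite phiX subr_eq0 invr_eq1 -subr_eq0.
split=> [i i2 ge3 n v bij_v|ge3 n v bij_v].
  (* At the first two branches [branch_index] computes to [p] and [q]. *)
  have p3 : (0 < i)%N -> (3 <= p)%N := ge3 ord0.
  have q3 : (1 < i)%N -> (3 <= q)%N := ge3 (lift ord0 ord0).
  rewrite (tofrac_coxeter_starS _ ge3 bij_v).
  rewrite (star_branches_leq2 X0 X1 r i2 p3 q3).

  rewrite !tofracB tofracM !tofracXn tofracD tofrac1.
  (* [F] is read at the indeterminate through [tofrac], and at its inverse through [phi]. *)
  rewrite -(rmorph_F _ _ _ X1) (recipE (F R i p q)).
  rewrite size_F ?(leq_trans i2) // (minn_idPl i2).
  by rewrite (rmorph_F _ _ _ phiX1) phiX.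
have p3 : (3 <= p)%N := ge3 ord0 isT.
have q3 : (3 <= q)%N := ge3 (lift ord0 ord0) isT.
have r3 : (3 <= r)%N := ge3 (lift ord0 (lift ord0 ord0)) isT.
(* No quotient occurs in this formula, so injectivity of [tofrac] reduces the polynomial identity to
   one between fractions. *)
apply/eqP; rewrite -tofrac_eq (tofrac_coxeter_starS _ ge3 bij_v).
rewrite (star_branches3 X0 p3 q3 r3).
rewrite tofracM tofracXn !tofracD tofrac1 [X in _ == _ * (X + _)]tofracM tofracXn.
rewrite -(rmorph_F _ _ _ X1) (recipE (F R 3 p q)).
by rewrite size_F // (rmorph_F _ _ _ phiX1) phiX.
Qed.
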